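(* Let $\mathcal{C}$ be an ideal of graphs. If $G'$ is a topological minor of a graph $G$, then $$e_{\mathcal{C}}(G') \le e_{\mathcal{C}}(G),\qquad \kappa_{\mathcal{C}}(G') \le \kappa_{\mathcal{C}}(G),\qquad\text{and}\qquad \nu_{\mathcal{C}}(G') \le \nu_{\mathcal{C}}(G).$$
   Context: All graphs are finite and simple. $H$ is a topological minor of $G$ if $G$ has a subgraph isomorphic to a subdivision of $H$ (edges replaced by internally disjoint paths of length at least $1$). An ideal is a class of graphs closed under isomorphisms and taking topological minors. For an ideal $\mathcal{C}$ and a graph $G$: - $e_{\mathcal{C}}(G)$ (edit distance) is the minimum of $|E(G')\triangle E(G)|$ over all $G'\in\mathcal{C}$ with $V(G')=V(G)$; equivalently, the minimum number of edges whose deletion from $G$ gives a graph in $\mathcal{C}$. - $\kappa_{\mathcal{C}}(G)$ ($\mathcal{C}$-vertex-brittleness) is the minimum $\ell$ such that there is a partition $(E_1,\dots,E_n)$ of $E(G)$ into nonempty parts for which the subgraph of $G$ induced by the edges in $E_i$ (consisting of those edges and their ends) belongs to $\mathcal{C}$ for each $i$, and the number of vertices incident with edges in distinct $E_i$'s is $\ell$. - $\nu_{\mathcal{C}}(G)$ ($\bar{\mathcal{C}}$-capacity) is the maximum $\ell$ such that there exist pairwise edge-disjoint subgraphs $H_1,\dots,H_\ell$ of $G$ with $H_i\notin\mathcal{C}$ for each $i$. In degenerate cases, a minimum over an empty set and a maximum over an unbounded set are $+\infty$. *)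

(* Defs.v *)
From HB Require Import structures.
From mathcomp Require Import all_boot.
From mathcomp Require Import boolp.

Set Implicit Arguments.
Unset Strict Implicit.
Unset Printing Implicit Defensive.

Definition two_sets (V : finType) (E : {set {set V}}) : bool :=
  [forall e in E, #|e| == 2].

Record graph := Graph {
  vertex :> finType;
  edges : {set {set vertex}};
  edgesP : two_sets edges }.

(* Irreflexive, since edges have exactly two elements. *)
Definition adj (G : graph) (x y : G) : bool := [set x; y] \in edges G.

Record subgraph (G : graph) := Subgraph {
  sub_vertices : {set G};
  sub_edges : {set {set G}};
  sub_edgesP : sub_edges \subset edges G;
  sub_incident : cover sub_edges \subset sub_vertices }.

Definition subgraph_edges (G : graph) (H : subgraph G) :
    {set {set {x : G | x \in sub_vertices H}}} :=
  [set e : {set {x : G | x \in sub_vertices H}} | val @: e \in sub_edges H].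

Lemma subgraph_edgesP (G : graph) (H : subgraph G) :
  two_sets (subgraph_edges H).
Proof.
apply/forall_inP => e; rewrite inE => He.
have := subsetP (sub_edgesP H) _ He.
by move/(forall_inP (edgesP G)); rewrite card_imset //; exact: val_inj.
Qed.

Coercion graph_of_subgraph (G : graph) (H : subgraph G) : graph :=
  Graph (subgraph_edgesP H).

(* The subgraph consisting of the edges of [G] in [F] and their ends; the
   intersection with [edges G] only serves to make this total in [F]. *)
Definition edge_induced (G : graph) (F : {set {set G}}) : subgraph G :=
  @Subgraph G (cover (F :&: edges G)) (F :&: edges G)
    (subsetIr F (edges G)) (subxx _).

Definition isomorphic (G H : graph) : Prop :=
  exists f : G -> H, bijective f /\
    forall e : {set G}, (f @: e \in edges H) = (e \in edges G).

(* Paths are given by their ends [x], [y] and the sequence [s] of their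
   internal vertices, so the length of the path is [(size s).+1 >= 1]. *)
Definition is_path (G : graph) (x : G) (s : seq G) (y : G) : bool :=
  path (@adj G) x (rcons s y) && uniq (x :: rcons s y).

Definition path_edges (G : graph) (x : G) (s : seq G) (y : G) :
    seq {set G} :=
  [seq [set a.1; a.2] | a <- zip (x :: s) (rcons s y)].

(* [S] is a subdivision of [H]: [f] gives the branch vertices, and the edge
   [xy] of [H] is replaced by the path with internal vertices [p x y]
   (read from [x] to [y]). *)
Definition subdivision (S H : graph) : Prop :=
  exists (f : H -> S) (p : H -> H -> seq S),
  [/\ injective f,
      forall x y, adj x y ->
        [/\ is_path (f x) (p x y) (f y), p y x = rev (p x y)
          & forall z, f z \notin p x y],
      forall x y x' y', adj x y -> adj x' y' ->
        [set x; y] != [set x'; y'] -> [disjoint p x y & p x' y'],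
      forall v : S, v \in codom f \/ exists x y, adj x y /\ v \in p x y
    & forall d, d \in edges S ->
        exists x y, adj x y /\ d \in path_edges (f x) (p x y) (f y)].

Definition topological_minor (H G : graph) : Prop :=
  exists (K : subgraph G) (S : graph), subdivision S H /\ isomorphic K S.

Definition ideal (C : graph -> Prop) : Prop :=
  (forall G H, isomorphic G H -> C G -> C H) /\
  (forall G H, topological_minor H G -> C G -> C H).

Inductive enat := Fin of nat | Infty.

Definition enat_le (a b : enat) : bool :=
  match a, b with
  | _, Infty => true
  | Infty, Fin _ => false
  | Fin m, Fin n => m <= n
  end.

(* By well-ordering, only the empty set has no minimum. *)
Definition minimum (P : nat -> Prop) : enat :=
  if pselect (exists n, P n /\ forall m, P m -> n <= m) is left h
  then Fin (projT1 (cid h)) else Infty.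

(* The set used in [capacity] contains 0, so there the maximum fails to exist
   only when the set is unbounded. *)
Definition maximum (P : nat -> Prop) : enat :=
  if pselect (exists n, P n /\ forall m, P m -> m <= n) is left h
  then Fin (projT1 (cid h)) else Infty.

Definition edit_distance (C : graph -> Prop) (G : graph) : enat :=
  minimum (fun k => exists (E' : {set {set G}}) (hE' : two_sets E'),
    C (Graph hE') /\ #|(E' :\: edges G) :|: (edges G :\: E')| = k).

Definition boundary (G : graph) (P : {set {set {set G}}}) : {set G} :=
  [set v | [exists A in P, exists B in P,
              [&& A != B, v \in cover A & v \in cover B]]].

(* [partition] requires the parts to be nonempty. *)
Definition vertex_brittleness (C : graph -> Prop) (G : graph) : enat :=
  minimum (fun k => exists P : {set {set {set G}}},
    [/\ partition P (edges G),
        forall F, F \in P -> C (edge_induced F)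
      & #|boundary P| = k]).

(* The [H i] need not be distinct: edgeless subgraphs may be repeated, which
   is how the capacity can be infinite. *)
Definition capacity (C : graph -> Prop) (G : graph) : enat :=
  maximum (fun l => exists H : 'I_l -> subgraph G,
    (forall i, ~ C (H i)) /\
    (forall i j, i != j -> [disjoint sub_edges (H i) & sub_edges (H j)])).

(* Main.v *)
(* Fix a subdivision of [G'] inside [G].
   Edit distance: delete from [G'] the edges whose path loses an edge; distinct
   edges have edge-disjoint paths.  Capacity: edge-disjoint subgraphs of [G']
   have edge-disjoint images in [G].
   Brittleness: view the partition as an edge coloring and shorten the paths
   one interior vertex at a time, replacing [a v b] by the edge [ab] and
   deleting [v].  If [av] and [vb] have the same color, [ab] inherits it.
   Otherwise [v] is a boundary vertex.  If [b] is not incident with the color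
   of [av], give this color to [ab]: [v] can play the role of [b] in that
   class, and [b] replaces [v] in the boundary; symmetrically for [a] and the
   color of [vb].  In the remaining case [a] and [b] are both boundary vertices
   already, and [ab] can be given a new color. *)
Require Import Defs.
From mathcomp Require Import all_boot.
From mathcomp Require Import boolp.

Set Implicit Arguments.
Unset Strict Implicit.
Unset Printing Implicit Defensive.

(** * Edges of walks *)

(** Recursive form of [path_edges] on a bare vertex type, so that the same walk can be read in hosts
    with different edge sets. *)
Fixpoint walk_edges (V : finType) (x : V) (s : seq V) (y : V) : seq {set V} :=
  if s is z :: s' then [set x; z] :: walk_edges z s' y else [:: [set x; y]].

Lemma path_edgesE (G : graph) (x : G) s y : path_edges x s y = walk_edges x s y.
Proof. by elim: s x => //= z s IH x; rewrite -IH. Qed.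

Lemma path_adjE (G : graph) (x : G) s y :
  path (@adj G) x (rcons s y) = all [in edges G] (walk_edges x s y).
Proof. by elim: s x => [|z s IH] x //=; rewrite IH. Qed.

Lemma map_walk_edges (V W : finType) (g : V -> W) x s y :
  walk_edges (g x) (map g s) (g y) =
  [seq g @: (e : {set V}) | e <- walk_edges x s y].
Proof.
by elim: s x => [|z s IH] x /=; rewrite ?IH imsetU1 imset_set1.
Qed.

Lemma walk_edges_rcons (V : finType) (x z : V) s y :
  walk_edges x (rcons s z) y = rcons (walk_edges x s z) [set z; y].
Proof. by elim: s x => [|w s IH] x //=; rewrite IH. Qed.

Lemma walk_edges_rev (V : finType) (x : V) s y :
  walk_edges y (rev s) x = rev (walk_edges x s y).
Proof.
elim: s x => [|z s IH] x /=; first by rewrite setUC.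
by rewrite !rev_cons walk_edges_rcons IH setUC.
Qed.

Lemma walk_edges_mem (V : finType) (x : V) s y d u :
  d \in walk_edges x s y -> u \in d -> u \in x :: rcons s y.
Proof.
elim: s x => [|z s IH] x /=.
  by rewrite !inE => /eqP->; rewrite !inE.
rewrite inE => /orP[/eqP->|/IH H /H].
  by rewrite !inE => /orP[]->; rewrite ?orbT.
by rewrite !inE => ->; rewrite orbT.
Qed.

Lemma walk_edges_cover (V : finType) (x : V) s y u :
  u \in x :: rcons s y -> exists2 d, d \in walk_edges x s y & u \in d.
Proof.
elim: s x => [|z s IH] x /=.
  by rewrite !inE => H; exists [set x; y]; rewrite !inE.
rewrite inE => /orP[/eqP->|/IH[d Hd Hu]].
  by exists [set x; z]; rewrite !inE eqxx.
by exists d; rewrite // inE Hd orbT.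
Qed.

Lemma adj_sym (G : graph) (x y : G) : adj x y = adj y x.
Proof. by rewrite /adj setUC. Qed.

Lemma adj_neq (G : graph) (x y : G) : adj x y -> x != y.
Proof.
by move/(forall_inP (edgesP G)); rewrite cards2; case: (x == y).
Qed.

Lemma adj_subgraph (G : graph) (L : subgraph G) (x y : L) :
  adj x y = ([set val x; val y] \in sub_edges L).
Proof. by rewrite /adj inE imsetU1 imset_set1. Qed.

Lemma two_setsE (V : finType) (E : {set {set V}}) d :
  two_sets E -> d \in E -> exists x y, x != y /\ d = [set x; y].
Proof. by move=> /forall_inP h /h /cards2P[x [y [? ->]]]; exists x, y. Qed.

Lemma edge_adj (G : graph) d :
  d \in edges G -> exists x y : G, adj x y /\ d = [set x; y].
Proof.
move=> hd; have [x [y [_ e]]] := two_setsE (edgesP G) hd.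
by exists x, y; rewrite /adj -e.
Qed.

(** * Subdivisions as linkages *)

(* A subdivision of [H] inside the graph with edge set [E]: the first three
   clauses of [subdivision], on a bare vertex type. *)
Definition linkage (H : graph) (V : finType) (E : {set {set V}})
    (f : H -> V) (p : H -> H -> seq V) : Prop :=
  [/\ injective f,
      forall x y, adj x y ->
        [/\ {subset walk_edges (f x) (p x y) (f y) <= E},
            uniq (f x :: rcons (p x y) (f y)), p y x = rev (p x y)
          & forall z, f z \notin p x y]
    & forall x y x' y', adj x y -> adj x' y' ->
        [set x; y] != [set x'; y'] -> [disjoint p x y & p x' y']].

Lemma linkage_nil (H : graph) (V : finType) (E : {set {set V}}) (f : H -> V) :
  injective f -> (forall x y, adj x y -> [set f x; f y] \in E) ->
  linkage E f (fun _ _ => [::]).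
Proof.
move=> fI fE; split=> // x y xy; last by move=> *; rewrite disjoint_has.
split=> //=; first by move=> d; rewrite inE => /eqP->; apply: fE.
by rewrite inE andbT (inj_eq fI) adj_neq.
Qed.

(** Every interior vertex lies on an edge of its path, hence in [sub_vertices L], so [pmap insub]
    drops nothing. Branch vertices need a hypothesis of their own, since an isolated vertex of [H]
    lies on no path. *)
Lemma linkage_lift (H G : graph) (L : subgraph G) (f : H -> G) p :
  linkage (sub_edges L) f p -> (forall x, f x \in sub_vertices L) ->
  exists (f' : H -> L) (p' : H -> H -> seq L),
    [/\ linkage (edges L) f' p', forall x, val (f' x) = f x
      & forall x y, adj x y -> map val (p' x y) = p x y].
Proof.
move=> [fI fp fD] fV.
pose f' x : L := Sub (f x) (fV x).
pose p' x y : seq L := pmap insub (p x y).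
have p'E x y : adj x y -> map val (p' x y) = p x y.
  move=> xy; have [sE _ _ _] := fp _ _ xy.
  have : all [in sub_vertices L] (p x y).
    apply/allP=> u hu.
    have [|d /sE hd ud] := @walk_edges_cover _ (f x) (p x y) (f y) u.
      by rewrite inE mem_rcons inE hu !orbT.
    by apply: (subsetP (sub_incident L)); apply/bigcupP; exists d.
  rewrite /p'; elim: (p x y) => //= u s IH /andP[hu hs].
  by rewrite insubT /= IH.
have f'E x : val (f' x) = f x by [].
exists f', p'; split=> //; split.
- by move=> x y /(congr1 val); apply: fI.
- move=> x y xy; have [sE un rv br] := fp _ _ xy.
  have yx : adj y x by rewrite adj_sym.
  split.
  + move=> d hd; rewrite inE; apply: sE.
    by rewrite -!f'E -p'E // map_walk_edges map_f.
  + by rewrite -(map_inj_uniq val_inj) /= map_rcons p'E.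
  + by apply: (@inj_map _ _ (val : L -> G) val_inj); rewrite map_rev !p'E.
  + by move=> z; rewrite -(mem_map val_inj) p'E //; apply: br.
- move=> x y x' y' xy xy' ne; have := fD _ _ _ _ xy xy' ne.
  rewrite -!p'E // !disjoint_has => /hasPn h; apply/hasPn => u hu.
  by rewrite /= -(mem_map val_inj); apply: h; rewrite map_f.
Qed.

Definition linkage_edges (H : graph) (V : finType) (f : H -> V)
    (p : H -> H -> seq V) (F : {set {set H}}) : {set {set V}} :=
  [set d | [exists x, exists y, ([set x; y] \in F) &&
                                (d \in walk_edges (f x) (p x y) (f y))]].

Lemma linkage_edgesP (H : graph) (V : finType) (f : H -> V) p
    (F : {set {set H}}) d :
  reflect (exists x y, [set x; y] \in F /\ d \in walk_edges (f x) (p x y) (f y))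
          (d \in linkage_edges f p F).
Proof.
rewrite inE; apply: (iffP existsP) => [[x /existsP[y /andP[]]]|[x [y []]]].
  by move=> *; exists x, y.
by move=> h1 h2; exists x; apply/existsP; exists y; rewrite h1.
Qed.

Lemma linkage_edges_sub (H G : graph) (f : H -> G) p (F : {set {set H}}) :
  linkage (edges G) f p -> F \subset edges H ->
  linkage_edges f p F \subset edges G.
Proof.
move=> [_ fp _] /subsetP sF; apply/subsetP => d /linkage_edgesP[x [y [/sF xy]]].
by have [h _ _ _] := fp _ _ xy; apply: h.
Qed.

(** The image of [L] under the subdivision; [f @: sub_vertices L] keeps the images of isolated
    vertices. *)
Definition linkage_subgraph (H G : graph) (f : H -> G) p
    (fp : linkage (edges G) f p) (L : subgraph H) : subgraph G :=
  @Subgraph G (f @: sub_vertices L :|: cover (linkage_edges f p (sub_edges L)))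
    (linkage_edges f p (sub_edges L))
    (linkage_edges_sub fp (sub_edgesP L)) (subsetUr _ _).

(** The image [K] of the whole of [H] has only branch vertices, path vertices and path edges, so it
    is itself a subdivision of [H], and the required isomorphism is the identity. *)
Lemma linkage_topological_minor (H G : graph) (f : H -> G) p :
  linkage (edges G) f p -> topological_minor H G.
Proof.
move=> fp.
pose T : subgraph H := @Subgraph H setT (edges H) (subxx _) (subsetT _).
pose K := linkage_subgraph fp T.
have [fI fpP fD] := fp.
have fK : linkage (sub_edges K) f p.
  split=> // x y xy; have [sE un rv br] := fpP _ _ xy.
  by split=> // d hd; apply/linkage_edgesP; exists x, y.
have fV x : f x \in sub_vertices K by rewrite inE imset_f ?inE.
have [f' [p' [[f'I f'p f'D] f'E p'E]]] := linkage_lift fK fV.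
exists K, K; split; last first.
  by exists id; split; [exists id|move=> e; rewrite imset_id].
exists f', p'; split=> //.
- move=> x y xy; have [sE un rv br] := f'p _ _ xy.
  by split=> //; rewrite /is_path path_adjE un andbT; apply/allP.
- move=> v; have := valP v; rewrite inE => /orP[/imsetP[x _ e]|].
    by left; apply/codomP; exists x; apply: val_inj; rewrite f'E.
  move=> /bigcupP[d /linkage_edgesP[x [y [xy hd]]] vd].
  have := walk_edges_mem hd vd.
  rewrite -!f'E -p'E // -map_rcons -map_cons (mem_map val_inj).
  rewrite inE mem_rcons inE => /or3P[/eqP->|/eqP->|h].
  + by left; apply: codom_f.
  + by left; apply: codom_f.
  + by right; exists x, y.
- move=> d; rewrite inE => /linkage_edgesP[x [y [xy hd]]].
  exists x, y; split=> //; rewrite path_edgesE.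
  move: hd; rewrite -!f'E -p'E // map_walk_edges mem_map //.
  exact: imset_inj val_inj.
Qed.

Lemma topological_minor_linkage (H G : graph) :
  topological_minor H G -> exists f p, @linkage H G (edges G) f p.
Proof.
case=> K [S [[f [p [fI fp fD fV fE]]] [g [[g' gK g'K] gE]]]].
have g'I : injective g' by apply: can_inj g'K.
pose h (v : S) : G := val (g' v).
have hI : injective h by move=> u v /val_inj /g'I.
exists (fun x => h (f x)), (fun x y => map h (p x y)); split.
- by move=> x y /hI /fI.
- move=> x y xy; have [/andP[pE un] rv br] := fp _ _ xy.
  split.
  + move=> d; rewrite map_walk_edges => /mapP[e he ->].
    move: pE; rewrite path_adjE => /allP /(_ _ he) /= eS.
    apply: (subsetP (sub_edgesP K)).
    have : g' @: e \in edges K.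
      have g'K' : g \o g' =1 id := g'K.
      by rewrite -gE -imset_comp (eq_imset _ g'K') imset_id.
    by rewrite inE -imset_comp.
  + by rewrite -map_rcons -map_cons (map_inj_uniq hI).
  + by rewrite rv map_rev.
  + by move=> z; rewrite (mem_map hI).
- move=> x y x' y' xy xy' ne; have := fD _ _ _ _ xy xy' ne.
  rewrite !disjoint_has => /hasPn d; apply/hasPn => u /mapP[v hv ->].
  by rewrite /= (mem_map hI); apply: d.
Qed.

(** Suppose two different edges of [H] had paths sharing [d]. An end of [d] interior to one path
    could be neither interior to the other nor a branch vertex, so [d] joins two branch vertices and
    is the image under [f] of both edges, against injectivity. *)
Lemma linkage_edges_inj (H : graph) (V : finType) (E : {set {set V}}) f p
    (x y x' y' : H) d :
  two_sets E -> linkage E f p -> adj x y -> adj x' y' ->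
  d \in walk_edges (f x) (p x y) (f y) ->
  d \in walk_edges (f x') (p x' y') (f y') -> [set x; y] = [set x'; y'].
Proof.
move=> hE [fI fp fD] xy xy' hd hd'; apply/eqP/negPn/negP => ne.
have sub u v u' v' : adj u v -> adj u' v' -> [set u; v] != [set u'; v'] ->
    d \in walk_edges (f u) (p u v) (f v) ->
    d \in walk_edges (f u') (p u' v') (f v') -> d = f @: [set u; v].
  move=> uv uv' neq hu hu'.
  have [sE _ _ br] := fp _ _ uv; have [_ _ _ br'] := fp _ _ uv'.
  apply/eqP; rewrite eqEcard card_imset // (eqP (forall_inP (edgesP H) _ uv)).
  rewrite (eqP (forall_inP hE _ (sE _ hu))).
  rewrite andbT; apply/subsetP => w wd.
  have := walk_edges_mem hu wd; rewrite inE mem_rcons inE => /or3P[||h].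
  + by move/eqP->; rewrite imset_f // !inE eqxx.
  + by move/eqP->; rewrite imset_f // !inE eqxx orbT.
  have := walk_edges_mem hu' wd; rewrite inE mem_rcons inE => /or3P[||h'].
  + by move=> /eqP e; rewrite e (negPf (br _)) in h.
  + by move=> /eqP e; rewrite e (negPf (br _)) in h.
  by have := disjointFr (fD _ _ _ _ uv uv' neq) h; rewrite h'.
have e1 := sub _ _ _ _ xy xy' ne hd hd'.
rewrite eq_sym in ne; have e2 := sub _ _ _ _ xy' xy ne hd' hd.
by move: ne; rewrite (imset_inj fI (etrans (esym e1) e2)) eqxx.
Qed.

Lemma ideal_linkage (C : graph -> Prop) (G H : graph) (L : subgraph G) f p :
  ideal C -> @linkage H G (sub_edges L) f p ->
  (forall x, f x \in sub_vertices L) -> C L -> C H.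
Proof.
move=> hC fp fV; have [f' [p' [fp' _ _]]] := linkage_lift fp fV.
exact: hC.2 (linkage_topological_minor fp').
Qed.

Lemma ideal_linkage_graph (C : graph -> Prop) (G H : graph) f p :
  ideal C -> @linkage H G (edges G) f p -> C G -> C H.
Proof. by move=> hC /linkage_topological_minor; apply: hC.2. Qed.

Lemma linkage_subgraphP (H G : graph) (f : H -> G) p
    (fp : linkage (edges G) f p) (L : subgraph H) :
  linkage (sub_edges (linkage_subgraph fp L)) (fun x : L => f (val x))
    (fun x y => p (val x) (val y)).
Proof.
have [fI fpP fD] := fp.
have aE (x y : L) : adj x y -> adj (val x) (val y).
  by rewrite adj_subgraph; apply: (subsetP (sub_edgesP L)).
split=> [x y /fI /val_inj //|x y xy|x y x' y' xy xy' ne].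
  have [sE un rv br] := fpP _ _ (aE _ _ xy).
  split=> // d hd; apply/linkage_edgesP; exists (val x), (val y).
  by rewrite -adj_subgraph.
apply: fD; [exact: aE|exact: aE|apply: contra ne => /eqP e].
apply/eqP/(imset_inj (f := val)); first exact: val_inj.
by rewrite !imsetU1 !imset_set1.
Qed.

(** * Comparison of minima and maxima *)

Lemma minimum_le (P Q : nat -> Prop) :
  (forall k, P k -> exists2 l, l <= k & Q l) ->
  enat_le (minimum Q) (minimum P).
Proof.
move=> PQ; rewrite /minimum.
case: (pselect (exists n, P n /\ _)) => [hP|_]; last by case: pselect.
case: (cid hP) => n /= [Pn _]; have [l ln Ql] := PQ n Pn.
case: pselect => [hQ|[]].
  by case: (cid hQ) => m /= [_ /(_ l Ql) ml]; apply: leq_trans ln.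
have exQ : exists k, `[< Q k >] by exists l; apply/asboolP.
exists (ex_minn exQ); case: ex_minnP => m /asboolP Qm mm; split=> // k Qk.
by apply: mm; apply/asboolP.
Qed.

(** A bound for [P] also bounds [Q]. [Q 0] makes [Q] nonempty; the [maximum] of an empty set would
    be [Infty]. *)
Lemma maximum_le (P Q : nat -> Prop) :
  Q 0 -> (forall k, Q k -> P k) -> enat_le (maximum Q) (maximum P).
Proof.
move=> Q0 QP; rewrite /maximum.
case: (pselect (exists n, P n /\ _)) => [hP|_]; last by case: pselect.
case: (cid hP) => n /= [_ Pn].
case: pselect => [hQ|[]].
  by case: (cid hQ) => m /= [Qm _]; apply/Pn/QP.
have exQ : exists k, `[< Q k >] by exists 0; apply/asboolP.
have ubQ k : `[< Q k >] -> k <= n by move/asboolP/QP/Pn.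
exists (ex_maxn exQ ubQ); case: ex_maxnP => m /asboolP Qm mm; split=> // k Qk.
by apply: mm; apply/asboolP.
Qed.

(** * Edit distance and capacity *)

Lemma edit_distance_le (C : graph -> Prop) (G G' : graph) f p :
  ideal C -> @linkage G' G (edges G) f p ->
  enat_le (edit_distance C G') (edit_distance C G).
Proof.
move=> hC fp; have [fI fpP fD] := fp.
apply: minimum_le => k [E' [hE' [CE' kE]]].
pose good x y := all [in E'] (walk_edges (f x) (p x y) (f y)).
(* An edge can be written with its ends in either order; the reversed path has the same edges. *)
have goodC x y : adj x y -> good x y = good y x.
  move=> xy; have [_ _ rv _] := fpP _ _ xy.
  by rewrite /good rv walk_edges_rev all_rev.
pose E'' := [set e in edges G' |
  [exists x, exists y, (e == [set x; y]) && good x y]].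
have E''P x y : [set x; y] \in E'' = adj x y && good x y.
  rewrite inE /adj; case xy: (_ \in edges G') => //=.
  apply/existsP/idP => [[x' /existsP[y' /andP[/eqP e g]]]|g]; last first.
    by exists x; apply/existsP; exists y; rewrite eqxx.
  have : x' \in [set x; y] by rewrite e !inE eqxx.
  have : y' \in [set x; y] by rewrite e !inE eqxx orbT.
  have xy' : adj x' y' by rewrite /adj -e.
  have := adj_neq xy'; rewrite !inE => nxy /orP[]/eqP ey /orP[]/eqP ex.
  - by rewrite ey ex eqxx in nxy.
  - by rewrite goodC // -ex -ey.
  - by rewrite -ex -ey.
  - by rewrite ey ex eqxx in nxy.
have hE'' : two_sets E''.
  by apply/forall_inP => e; rewrite inE => /andP[/(forall_inP (edgesP G'))].
have E''s : E'' \subset edges G' by apply/subsetP => e; rewrite inE => /andP[].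
exists #|(E'' :\: edges G') :|: (edges G' :\: E'')|; last first.
  exists E'', hE''; split=> //.
  (* The kept edges are those whose whole path survives in [E'], so the same [f] and [p] link the
     two edited graphs. *)
  apply: (@ideal_linkage_graph C (Graph hE') (Graph hE'') f p hC _ CE').
  split=> // x y; last first.
    move=> x' y'; rewrite /adj /= !E''P => /andP[xy _] /andP[xy' _].
    exact: fD.
  rewrite {1}/adj /= E''P => /andP[xy g].
  by have [? ? ? ?] := fpP _ _ xy; split=> // d hd; apply: (allP g).
have -> : E'' :\: edges G' = set0 by apply/eqP; rewrite setD_eq0.
rewrite set0U -kE.
(* [E''] only deletes edges, so the deletions made by [E'] alone already suffice as a bound. *)
apply: (@leq_trans #|edges G :\: E'|); last by rewrite subset_leq_card ?subsetUr.
have bad e : e \in edges G' :\: E'' -> exists d, exists x, exists y,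
    [/\ d \in edges G :\: E', e = [set x; y] &
        d \in walk_edges (f x) (p x y) (f y)].
  rewrite inE => /andP[eE /edge_adj[x [y [xy ee]]]].
  move: eE; rewrite ee E''P xy /= => /allPn[d hd dE].
  exists d, x, y; split=> //; rewrite inE dE /=.
  by have [sE _ _ _] := fpP _ _ xy; apply: sE.
(* [h] picks a lost edge on the path of each deleted edge; the default [set0] is never reached on
   deleted edges. *)
pose h e : {set G} := if pselect (exists d, exists x, exists y,
    [/\ d \in edges G :\: E', e = [set x; y] &
        d \in walk_edges (f x) (p x y) (f y)]) is left H
  then projT1 (cid H) else set0.
have hP e : e \in edges G' :\: E'' -> exists x y,
    [/\ h e \in edges G :\: E', e = [set x; y] &
        h e \in walk_edges (f x) (p x y) (f y)].
  by move=> /bad; rewrite /h; case: pselect => // H _; case: (cid H).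
rewrite -(card_in_imset (f := h)); last first.
  move=> e e' he he'.
  have [x [y [_ ee hx]]] := hP _ he; have [x' [y' [_ ee' hx']]] := hP _ he'.
  move=> eq; rewrite ee ee'; rewrite eq in hx.
  apply: (linkage_edges_inj (edgesP G) fp _ _ hx hx').
    by rewrite /adj -ee; move: he; rewrite inE => /andP[].
  by rewrite /adj -ee'; move: he'; rewrite inE => /andP[].
apply/subset_leq_card/subsetP => d /imsetP[e he ->].
by have [? [? []]] := hP _ he.
Qed.

Lemma capacity_le (C : graph -> Prop) (G G' : graph) f p :
  ideal C -> @linkage G' G (edges G) f p ->
  enat_le (capacity C G') (capacity C G).
Proof.
move=> hC fp; apply: maximum_le => [|k [L [nC D]]].
  have e : subgraph G' by apply: (@Subgraph G' setT set0); rewrite ?sub0set ?subsetT.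
  by exists (fun _ => e); split; case.
exists (fun i => linkage_subgraph fp (L i)); split=> [i|i j ij].
  (* The image of [L i] contains a subdivision of [L i], so it cannot be in [C] either. *)
  move=> /(ideal_linkage hC (linkage_subgraphP fp (L i))) h.
  by apply: (nC i); apply: h => x; rewrite inE imset_f ?(valP x).
rewrite disjoint_subset; apply/subsetP => d /linkage_edgesP[x [y [xy hd]]].
rewrite inE; apply/linkage_edgesP => -[x' [y' [xy' hd']]].
have sE k' := subsetP (sub_edgesP (L k')).
have e := linkage_edges_inj (edgesP G) fp (sE _ _ xy) (sE _ _ xy') hd hd'.
by have := disjointFr (D _ _ ij) xy; rewrite e xy'.
Qed.

(** * Edge-induced subgraphs of the complete graph *)

Lemma pair_setP (V : finType) : two_sets [set e : {set V} | #|e| == 2].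
Proof. by apply/forall_inP => e; rewrite inE. Qed.

Definition complete_graph (V : finType) : graph := Graph (@pair_setP V).

(* Makes edge-induced subgraphs depend on the edge set only, so that the host
   graph can change during an argument. *)
Definition span (V : finType) (F : {set {set V}}) : subgraph (complete_graph V) :=
  @edge_induced (complete_graph V) F.

Lemma span_edges (V : finType) (F : {set {set V}}) d :
  (d \in sub_edges (span F)) = (d \in F) && (#|d| == 2).
Proof. by rewrite !inE. Qed.

Lemma span_vertex (V : finType) (F : {set {set V}}) (x : span F) :
  exists d, [/\ d \in F, #|d| == 2 & val x \in d].
Proof.
by have /bigcupP[d] := valP x; rewrite !inE => /andP[? ?] ?; exists d.
Qed.

(** Each edge serves as its own path of length one. Injectivity is asked only on the vertices
    covered by [F'], so [f] may send an uncovered vertex and a covered one to the same place. *)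
Lemma ideal_span (C : graph -> Prop) (V V' : finType) (F : {set {set V}})
    (F' : {set {set V'}}) (f : V' -> V) :
  ideal C -> {in cover F' &, injective f} ->
  (forall d, d \in F' -> f @: d \in F) -> C (span F) -> C (span F').
Proof.
move=> hC fI fF.
have sub (d : {set V'}) : d \in F' -> {subset d <= cover F'}.
  by move=> dF x xd; apply/bigcupP; exists d.
have fF2 (d : {set V'}) : d \in F' -> #|d| == 2 -> f @: d \in sub_edges (span F).
  move=> dF d2; rewrite span_edges fF // card_in_imset //.
  by move=> x y /(sub d dF) ? /(sub d dF) ?; apply: fI.
have cov (x : span F') : val x \in cover F'.
  by have [d [dF _ xd]] := span_vertex x; apply: sub xd.
apply: (@ideal_linkage C (complete_graph V) (span F') (span F)
          (fun x => f (val x)) (fun _ _ => [::]) hC).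
  apply: linkage_nil => [x y /fI e|x y]; first by apply/val_inj/e; apply: cov.
  rewrite adj_subgraph span_edges => /andP[xyF xy2].
  by have := fF2 _ xyF xy2; rewrite imsetU1 imset_set1.
move=> x; have [d [dF d2 xd]] := span_vertex x.
by apply/(subsetP (sub_incident (span F)))/bigcupP; exists (f @: d);
  [exact: fF2|exact: imset_f].
Qed.

Lemma ideal_spanS (C : graph -> Prop) (V : finType) (F F' : {set {set V}}) :
  ideal C -> F' \subset F -> C (span F) -> C (span F').
Proof.
move=> hC /subsetP s; apply: (ideal_span (f := id) hC) => // d dF.
by rewrite imset_id; apply: s.
Qed.

(** Both subgraphs have the same vertices and edges but different ambient graphs; the inclusions
    link each into the other. *)
Lemma edge_induced_span (C : graph -> Prop) (G : graph) (F : {set {set G}}) :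
  ideal C -> F \subset edges G -> C (edge_induced F) <-> C (span F).
Proof.
move=> hC sF.
have e : sub_edges (edge_induced F) = F by apply/setIidPl.
have e2 : sub_edges (span F) = F.
  apply/setIidPl/subsetP => d /(subsetP sF) dG; rewrite inE.
  exact: (forall_inP (edgesP G)).
have eV : sub_vertices (edge_induced F) = sub_vertices (span F).
  by rewrite -[LHS]/(cover (sub_edges (edge_induced F))) e -{1}e2.
split.
  apply: (@ideal_linkage C G (span F) (edge_induced F) val (fun _ _ => [::]) hC).
    apply: linkage_nil => [|x y]; first exact: val_inj.
    by rewrite adj_subgraph e e2.
  by move=> x; rewrite eV; apply: valP.
apply: (@ideal_linkage C (complete_graph G) (edge_induced F) (span F) val
          (fun _ _ => [::]) hC).
  apply: linkage_nil => [|x y]; first exact: val_inj.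
  by rewrite adj_subgraph e e2.
by move=> x; rewrite -eV; apply: valP.
Qed.

(** * Local changes of an edge-induced subgraph *)

(* The edge [ab] replaced by the path [a v b]. *)
Lemma ideal_span_subdivide (C : graph -> Prop) (V : finType)
    (F F' : {set {set V}}) (a v b : V) :
  ideal C -> uniq [:: a; v; b] -> [set a; v] \in F -> [set v; b] \in F ->
  v \notin cover F' -> F' \subset [set a; b] |: F ->
  C (span F) -> C (span F').
Proof.
move=> hC; rewrite /= !inE andbT negb_or => /andP[/andP[av ab] vb].
move=> avF vbF vF' /subsetP sF.
have cov d x : d \in F' -> x \in d -> x != v.
  by move=> dF xd; apply: contraNneq vF' => <-; apply/bigcupP; exists d.
have F2 d : d \in F -> #|d| == 2 -> d \in sub_edges (span F).
  by move=> ? ?; rewrite span_edges; apply/andP.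
pose p (x y : span F') := if [set val x; val y] == [set a; b] then [:: v] else [::].
have key (x y : V) : [set x; y] = [set a; b] -> x != y ->
    {subset [:: [set x; v]; [set v; y]] <= sub_edges (span F)}.
  move=> e xy; have : x \in [set a; b] by rewrite -e !inE eqxx.
  have : y \in [set a; b] by rewrite -e !inE eqxx orbT.
  have h1 : [set a; v] \in sub_edges (span F) by rewrite F2 // cards2 av.
  have h2 : [set v; b] \in sub_edges (span F) by rewrite F2 // cards2 vb.
  move=> + + d; rewrite mem_seq2 !in_set2.
  move=> /orP[]/eqP ey /orP[]/eqP ex; move: xy; rewrite ex ey ?eqxx // => _.
    by rewrite (setUC [set b] [set v]) (setUC [set v] [set a]) => /orP[]/eqP->.
  by move=> /orP[]/eqP->.
apply: (@ideal_linkage C (complete_graph V) (span F') (span F) val p hC).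
  split=> [|x y xy|x y x' y' _ _ ne]; first exact: val_inj.
    have nxy : val x != val y by apply: contraNneq (adj_neq xy) => /val_inj ->.
    move: xy; rewrite adj_subgraph span_edges => /andP[xyF xy2].
    have xv : val x != v by apply: cov xyF _; rewrite !inE eqxx.
    have yv : val y != v by apply: cov xyF _; rewrite !inE eqxx orbT.
    rewrite /p (setUC [set val y]); case: eqP => [e|/eqP ne]; split=> //.
    - exact: key.
    - by rewrite /= !inE negb_or xv nxy eq_sym yv.
    - move=> z; rewrite inE; have [d [dF _ zd]] := span_vertex z.
      exact: cov zd.
    - move=> d; rewrite inE => /eqP->; apply: F2 => //.
      by have := sF _ xyF; rewrite !inE (negPf ne).
    - by rewrite /= inE nxy.
  (* Only the edge ab has an interior vertex, so two paths that meet internally replace the same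
     edge. *)
  rewrite disjoint_has /p; case: eqP => // e; case: eqP => // e'.
  case/negP: ne; apply/eqP/(imset_inj (f := val)).
    exact: val_inj.
  by rewrite !imsetU1 !imset_set1 e e'.
move=> x; have [d [dF d2 xd]] := span_vertex x.
have e' (u w : V) : u \in [set w; v] -> [set w; v] \in sub_edges (span F) ->
    u \in sub_vertices (span F).
  move=> uwv h; apply: (subsetP (sub_incident (span F))); apply/bigcupP.
  by exists [set w; v].
move: (sF _ dF); rewrite !inE => /orP[/eqP e|dF2]; last first.
  apply: (subsetP (sub_incident (span F))); apply/bigcupP.
  by exists d => //; apply: F2.
move: xd; rewrite e !inE => /orP[]/eqP->.
  by apply: (e' _ a); [rewrite !inE eqxx|apply: F2; rewrite ?cards2 ?av].
apply: (e' _ b); first by rewrite !inE eqxx.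
by rewrite setUC; apply: F2; rewrite ?cards2 ?vb.
Qed.

(* The edge [ab] moved onto [av], using that [v] is free to play the role of
   [b]. *)
Lemma ideal_span_relocate (C : graph -> Prop) (V : finType)
    (F F' : {set {set V}}) (a v b : V) :
  ideal C -> a != b -> [set a; v] \in F -> v \notin cover F' ->
  (forall d, d \in F' -> d = [set a; b] \/ d \in F /\ b \notin d) ->
  C (span F) -> C (span F').
Proof.
move=> hC ab avF vF' sF.
(* Injective on the cover of [F'] because [v] is not in it; edges other than ab avoid [b] and are
   fixed. *)
pose f z := if z == b then v else z.
apply: (ideal_span (f := f) hC) => [x y xF yF|d /sF[->|[dF bd]]].
- rewrite /f; case: eqP => [->|_]; case: eqP => [->|_] // e.
    by rewrite e yF in vF'.
  by rewrite -e xF in vF'.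
- by rewrite imsetU1 imset_set1 /f eqxx (negPf ab).
have -> : f @: d = d; last by [].
rewrite -[RHS]imset_id; apply: eq_in_imset => z zd.
by rewrite /f; case: eqP => // e; rewrite -e zd in bd.
Qed.

(** * Edge colorings and suppression of a vertex *)

(** Colorings stand in for partitions: the nonempty classes are the parts, and with natural numbers
    as colors a fresh one is always available. *)
Definition color_class (V : finType) (E : {set {set V}}) (c : {set V} -> nat) k :=
  [set d in E | c d == k].

Definition ideal_coloring (C : graph -> Prop) (V : finType) (E : {set {set V}})
    (c : {set V} -> nat) : Prop :=
  forall e, e \in E -> C (span (color_class E c (c e))).

Definition color_boundary (V : finType) (E : {set {set V}})
    (c : {set V} -> nat) : {set V} :=
  [set v | [exists d in E, exists e in E, [&& v \in d, v \in e & c d != c e]]].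

Lemma color_boundaryP (V : finType) (E : {set {set V}}) c v :
  reflect (exists d e, [/\ d \in E, e \in E, v \in d, v \in e & c d != c e])
          (v \in color_boundary E c).
Proof.
rewrite inE; apply: (iffP exists_inP) => [[d dE /exists_inP[e eE /and3P[]]]|].
  by exists d, e.
move=> [d [e [dE eE vd ve ne]]]; exists d => //; apply/exists_inP; exists e => //.
exact/and3P.
Qed.

(** All edges at [v] go, including those off the path, so that [v] is free to replace another
    vertex. The edge ab may already be in [E]; [recolor] then overwrites its color. *)
Definition suppress (V : finType) (E : {set {set V}}) (a v b : V) :=
  [set a; b] |: [set e in E | v \notin e].

Definition recolor (V : finType) (c : {set V} -> nat) (a b : V) k (e : {set V}) :=
  if e == [set a; b] then k else c e.

Lemma suppressP (V : finType) (E : {set {set V}}) a v b e :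
  e \in suppress E a v b -> e != [set a; b] -> e \in E /\ v \notin e.
Proof. by rewrite !inE => /orP[->|/andP[]]. Qed.

Lemma suppress_cover (V : finType) (E : {set {set V}}) a v b :
  uniq [:: a; v; b] -> v \notin cover (suppress E a v b).
Proof.
rewrite /= !inE andbT negb_or => /andP[/andP[av ab] vb].
apply/bigcupP => -[d]; case: (eqVneq d [set a; b]) => [-> _|ne /suppressP[//|_]].
  by rewrite !inE (negPf vb) eq_sym (negPf av).
by move/negPf->.
Qed.

(** Classes of colors other than [k] only lose edges and stay in [C], which leaves the class of [k]
    to check. *)
Lemma recolor_coloring (C : graph -> Prop) (V : finType) (E : {set {set V}})
    c a v b k :
  ideal C -> ideal_coloring C E c ->
  C (span (color_class (suppress E a v b) (recolor c a b k) k)) ->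
  ideal_coloring C (suppress E a v b) (recolor c a b k).
Proof.
move=> hC cE Ck e eE; case: (eqVneq (recolor c a b k e) k) => [-> //|nk].
have neab : e != [set a; b].
  by apply: contraNneq nk => ->; rewrite /recolor eqxx.
have [eE' _] := suppressP eE neab.
apply: ideal_spanS (cE _ eE') => //; apply/subsetP => d.
rewrite inE => /andP[dE /eqP dk].
have ndab : d != [set a; b].
  by apply: contraNneq nk => dab; rewrite -dk /recolor dab eqxx.
have [dE' _] := suppressP dE ndab; rewrite inE dE' /=.
by move: dk; rewrite /recolor (negPf ndab) (negPf neab) => ->.
Qed.

(** An end of ab that already meets color [k] sees no new color; [Y] collects the ends that may. No
    remaining edge contains [v], so it leaves the boundary. *)
Lemma recolor_boundary (V : finType) (E : {set {set V}}) c (a v b : V) k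
    (Y : {set V}) :
  uniq [:: a; v; b] ->
  (forall u, u \in [set a; b] ->
     u \in Y \/ exists e, [/\ e \in E, u \in e & c e = k]) ->
  color_boundary (suppress E a v b) (recolor c a b k)
    \subset (color_boundary E c :|: Y) :\ v.
Proof.
move=> avb hY; apply/subsetP => u /color_boundaryP[d [e [dE eE ud ue ne]]].
have uv : u != v.
  apply: contraNneq (suppress_cover E avb) => uv.
  by apply/bigcupP; exists d; rewrite // -uv.
case uY: (u \in Y); first by rewrite !inE uY orbT uv.
have old d' : d' \in suppress E a v b -> u \in d' ->
    exists e', [/\ e' \in E, u \in e' & c e' = recolor c a b k d'].
  move=> dE' ud'; rewrite /recolor; case: eqP => [dab|/eqP ndab].
    by have [||h] := hY u; [rewrite -dab|rewrite uY|exact: h].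
  by have [? _] := suppressP dE' ndab; exists d'.
have [d' [d'E ud' cd']] := old d dE ud.
have [e' [e'E ue' ce']] := old e eE ue.
rewrite !inE uv; apply/orP; left.
have : u \in color_boundary E c.
  by apply/color_boundaryP; exists d', e'; split; rewrite ?cd' ?ce'.
by rewrite inE.
Qed.

Definition good_recoloring (C : graph -> Prop) (V : finType) (E E' : {set {set V}})
    c : Prop :=
  exists c', ideal_coloring C E' c' /\
             #|color_boundary E' c'| <= #|color_boundary E c|.

(** The edge ab takes the color of av. As [b] misses that color, av and vb differ in color, so [v]
    was in the boundary and its removal pays for [b], the only vertex that may enter. *)
Lemma suppress_relocate (C : graph -> Prop) (V : finType) (E : {set {set V}})
    c (a v b : V) :
  ideal C -> uniq [:: a; v; b] -> [set a; v] \in E -> [set v; b] \in E ->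
  ideal_coloring C E c ->
  b \notin cover (color_class E c (c [set a; v])) ->
  good_recoloring C E (suppress E a v b) c.
Proof.
move=> hC avb avE vbE cE nb; set k := c [set a; v] in nb.
have [ab vnb] : a != b /\ v != b.
  by move: avb; rewrite /= !inE negb_or => /and3P[/andP[]].
have bP e : e \in E -> b \in e -> c e != k.
  move=> eE be; apply: contraNneq nb => ek; apply/bigcupP; exists e => //.
  by rewrite inE eE ek eqxx.
exists (recolor c a b k); split.
  apply: recolor_coloring => //.
  apply: (@ideal_span_relocate C V (color_class E c k) _ a v b hC ab);
    last exact: cE.
  - by rewrite inE avE eqxx.
  - apply: contraNN (suppress_cover E avb) => /bigcupP[d].
    by rewrite inE => /andP[dE _] vd; apply/bigcupP; exists d.
  move=> d; rewrite inE => /andP[dE dk].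
  case: (eqVneq d [set a; b]) => [|ne]; [by left|right].
  have [dE' _] := suppressP dE ne; move: dk; rewrite /recolor (negPf ne) => dk.
  by rewrite inE dE' dk; split=> //; apply: contraTN dk => /(bP _ dE').
have vB : v \in color_boundary E c.
  apply/color_boundaryP; exists [set a; v], [set v; b].
  split; rewrite ?inE ?eqxx ?orbT // eq_sym; apply: bP => //.
  by rewrite !inE eqxx orbT.
apply: leq_trans (subset_leq_card (recolor_boundary (Y := [set b]) avb _)) _.
  move=> u; rewrite !inE => /orP[]/eqP->; [right|by left; rewrite eqxx].
  by exists [set a; v]; rewrite !inE eqxx.
rewrite setDUl; apply: (leq_trans (leq_card_setU _ _)).
rewrite [leqRHS](cardsD1 v) vB addnC leq_add2r.
by apply: leq_trans (subset_leq_card (subsetDl _ _)) _; rewrite cards1.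
Qed.

Lemma suppress_coloring (C : graph -> Prop) (V : finType) (E : {set {set V}})
    c (a v b : V) :
  ideal C -> uniq [:: a; v; b] -> [set a; v] \in E -> [set v; b] \in E ->
  ideal_coloring C E c -> good_recoloring C E (suppress E a v b) c.
Proof.
move=> hC avb avE vbE cE.
case: (boolP (b \in cover (color_class E c (c [set a; v])))) => [hb|]; last first.
  exact: suppress_relocate.
(* The mirror case: read the path as b v a. *)
case: (boolP (a \in cover (color_class E c (c [set v; b])))) => [ha|na]; last first.
  have -> : suppress E a v b = suppress E b v a.
    by rewrite /suppress (setUC [set a]).
  have [bv va] : [set b; v] = [set v; b] /\ [set v; a] = [set a; v].
    by split; apply: setUC.
  by apply: suppress_relocate; rewrite ?bv ?va // -rev_uniq.
have [ab vnb] : a != b /\ v != b.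
  by move: avb; rewrite /= !inE negb_or => /and3P[/andP[]].
have vcov k' c' : v \notin cover (color_class (suppress E a v b) c' k').
  apply: contraNN (suppress_cover E avb) => /bigcupP[d].
  by rewrite inE => /andP[dE _] vd; apply/bigcupP; exists d.
case: (eqVneq (c [set a; v]) (c [set v; b])) => [e|ne].
  pose k := c [set a; v]; exists (recolor c a b k); split.
    apply: recolor_coloring => //.
    apply: (@ideal_span_subdivide C V (color_class E c k) _ a v b hC avb);
      last exact: cE.
    - by rewrite inE avE eqxx.
    - by rewrite inE vbE /k e eqxx.
    - exact: vcov.
    apply/subsetP => d; rewrite inE => /andP[dE dk].
    case: (eqVneq d [set a; b]) => [->|nd]; first by rewrite !inE eqxx.
    have [dE' _] := suppressP dE nd; move: dk; rewrite /recolor (negPf nd) => dk.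
    by rewrite !inE dE' dk orbT.
  apply/subset_leq_card/(subset_trans (recolor_boundary (Y := set0) avb _)).
    move=> u; rewrite !inE => /orP[]/eqP->; right.
      by exists [set a; v]; rewrite !inE eqxx.
    by exists [set v; b]; rewrite !inE eqxx orbT.
  by rewrite setU0 subsetDl.
(* A color above all those used on [E], so its class is the single edge ab; it is in [C] because the
   class of av contains an edge. *)
pose k := (\max_(e in E) c e).+1; exists (recolor c a b k); split.
  apply: recolor_coloring => //.
  apply: (@ideal_span_relocate C V (color_class E c (c [set a; v])) _ a v b hC ab);
    last exact: cE.
  - by rewrite inE avE eqxx.
  - exact: vcov.
  move=> d; rewrite inE => /andP[dE dk]; left; apply/eqP/negPn/negP => nd.
  have [dE' _] := suppressP dE nd; move: dk; rewrite /recolor (negPf nd).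
  by rewrite ltn_eqF // ltnS; apply: (@leq_bigmax_cond _ [in E] c).
(* Both ends may see the new color, but each already meets the two different colors of av and vb. *)
apply/subset_leq_card/(subset_trans (recolor_boundary (Y := [set a; b]) avb _)).
  by move=> u; left.
apply: (subset_trans (subsetDl _ _)); rewrite subUset subxx /=.
apply/subsetP => u; rewrite !inE => /orP[]/eqP->; rewrite -/(_ \in _).
- have /bigcupP[d] := ha; rewrite inE => /andP[dE /eqP cd] ad.
  have : a \in color_boundary E c.
    apply/color_boundaryP; exists [set a; v], d; split=> //.
      by rewrite !inE eqxx.
    by rewrite cd.
  by rewrite inE.
- have /bigcupP[d] := hb; rewrite inE => /andP[dE /eqP cd] bd.
  have : b \in color_boundary E c.
    apply/color_boundaryP; exists d, [set v; b]; split=> //.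
      by rewrite !inE eqxx orbT.
    by rewrite cd.
  by rewrite inE.
Qed.

(** * Shortening the paths of a linkage *)

Definition linkage_interior (H : graph) (V : finType) (p : H -> H -> seq V) :=
  [set v | [exists x, exists y, adj x y && (v \in p x y)]].

Lemma linkage_interiorP (H : graph) (V : finType) (p : H -> H -> seq V) v :
  reflect (exists x y, adj x y /\ v \in p x y) (v \in linkage_interior p).
Proof.
rewrite inE; apply: (iffP existsP) => [[x /existsP[y /andP[]]]|[x [y []]]].
  by move=> *; exists x, y.
by move=> h1 h2; exists x; apply/existsP; exists y; rewrite h1.
Qed.

(** [v] is the first interior vertex, so its neighbors on the path are [f x] and the next interior
    vertex, or [f y] by the default of [head]. Filtering shortens [p x y] and [p y x] together and
    leaves the other paths intact, since [v] is on none of them. *)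
Lemma linkage_suppress (H : graph) (V : finType) (E : {set {set V}})
    (f : H -> V) p (x y : H) v s :
  linkage E f p -> adj x y -> p x y = v :: s ->
  linkage (suppress E (f x) v (head (f y) s)) f
    (fun x' y' => [seq u <- p x' y' | u != v]).
Proof.
move=> [fI fp fD] xy pxy; set E1 := suppress _ _ _ _.
have subE d : d \in E -> v \notin d -> d \in E1.
  by move=> dE vd; rewrite !inE dE vd orbT.
have vp x' y' : adj x' y' -> [set x; y] != [set x'; y'] -> v \notin p x' y'.
  move=> xy' ne; have := fD _ _ _ _ xy xy' ne; rewrite pxy disjoint_has /=.
  by rewrite negb_or => /andP[].
have vf z : v != f z.
  have [_ _ _ /(_ z)] := fp _ _ xy; rewrite pxy inE negb_or eq_sym.
  by case/andP.
have vs : v \notin rcons s (f y).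
  by have [_ + _ _] := fp _ _ xy; rewrite pxy /= => /and3P[].
have sv : [seq u <- s | u != v] = s.
  apply/all_filterP/allP => u us; apply: contraNneq vs => <-.
  by rewrite mem_rcons inE us orbT.
(* The first edge of the shortened path is the new one; the others avoid [v] because the path does
   not repeat vertices. *)
have walk_xy : {subset walk_edges (f x) s (f y) <= E1}.
  have [sE _ _ _] := fp _ _ xy; move: sE; rewrite pxy /=.
  have rest u s' w : {subset walk_edges u s' w <= E} ->
      v \notin u :: rcons s' w -> {subset walk_edges u s' w <= E1}.
    move=> h nv d hd; apply: subE; first exact: h.
    by apply: contraNN nv; apply: walk_edges_mem hd.
  case: s {pxy sv} vs @E1 subE rest => [|w s] vs E1 subE rest sE d /=.
    by rewrite inE => /eqP->; rewrite !inE eqxx.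
  rewrite inE => /orP[/eqP->|]; first by rewrite !inE eqxx.
  by apply: rest => // e he; apply: sE; rewrite /= !inE he !orbT.
split=> // [x' y' xy'|x' y' x'' y'' xy' xy'' ne]; last first.
  have := fD _ _ _ _ xy' xy'' ne; rewrite !disjoint_has => /hasPn h.
  apply/hasPn => u; rewrite mem_filter => /andP[_ /h] /=.
  by apply: contraNN; rewrite mem_filter => /andP[].
have [sE un rv br] := fp _ _ xy'.
split.
- case: (eqVneq [set x; y] [set x'; y']) => [e|ne].
    have [[ex ey]|[ex ey]] : (x' = x /\ y' = y) \/ (x' = y /\ y' = x).
      have : x' \in [set x; y] by rewrite e !inE eqxx.
      have : y' \in [set x; y] by rewrite e !inE eqxx orbT.
      have := adj_neq xy'; rewrite !inE => nxy.
      move=> /orP[]/eqP ey /orP[]/eqP ex; rewrite ex ey; auto.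
      - by rewrite ex ey eqxx in nxy.
      - by rewrite ex ey eqxx in nxy.
    + by rewrite ex ey pxy /= eqxx sv.
    + have [_ _ rv' _] := fp _ _ xy.
      rewrite ex ey rv' filter_rev pxy /= eqxx sv walk_edges_rev.
      by move=> d; rewrite mem_rev; apply: walk_xy.
  have nv := vp _ _ xy' ne.
  have -> : [seq u <- p x' y' | u != v] = p x' y'.
    by apply/all_filterP/allP => u up; apply: contraNneq nv => <-.
  move=> d hd; apply: subE; first exact: sE.
  apply/negP => /(walk_edges_mem hd).
  by rewrite inE mem_rcons inE !(negPf (vf _)) (negPf nv).
- apply: subseq_uniq un.
  by rewrite /= eqxx -!cats1; apply: cat_subseq => //; apply: filter_subseq.
- by rewrite rv filter_rev.
- by move=> z; rewrite mem_filter negb_and br orbT.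
Qed.

(** Induction on the number of interior vertices. The host edge set changes at each step, hence a
    variable [E] in place of a fixed graph. *)
Lemma linkage_coloring (C : graph -> Prop) (H : graph) (V : finType)
    (E : {set {set V}}) (f : H -> V) p c :
  ideal C -> linkage E f p -> ideal_coloring C E c ->
  exists c', ideal_coloring C (edges H) c' /\
             #|color_boundary (edges H) c'| <= #|color_boundary E c|.
Proof.
move=> hC; have [n] := ubnP #|linkage_interior p|.
elim: n E p c => // n IH E p c; rewrite ltnS => len fp cE.
(* Without interior vertices every path is one edge, and the coloring pulls back along [f]. *)
case: (set_0Vmem (linkage_interior p)) => [p0|[w /linkage_interiorP]].
  have [fI fpP _] := fp.
  have fE e : e \in edges H -> f @: e \in E.
    move=> /edge_adj[x [y [xy ->]]]; have [sE _ _ _] := fpP _ _ xy.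
    apply: sE; case pxy: (p x y) => [|v s].
      by rewrite /= imsetU1 imset_set1 inE.
    have : v \in linkage_interior p.
      by apply/linkage_interiorP; exists x, y; rewrite pxy inE eqxx.
    by rewrite p0 inE.
  exists (fun e : {set H} => c (f @: e)); split.
    move=> e eE; apply: (ideal_span (f := f) hC) (cE _ (fE _ eE)).
      by move=> x y _ _; apply: fI.
    by move=> d; rewrite !inE => /andP[dE ->]; rewrite fE.
  rewrite -(card_imset _ fI); apply/subset_leq_card/subsetP => u.
  move=> /imsetP[z /color_boundaryP[d [e [dE eE zd ze ne]]] ->].
  by apply/color_boundaryP; exists (f @: d), (f @: e); rewrite !fE ?imset_f.
case=> x [y [xy]]; case pxy: (p x y) => [//|v s] _.
have fp1 := linkage_suppress fp xy pxy.
have [fI fpP _] := fp; have [sE un _ _] := fpP _ _ xy.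
rewrite pxy in sE un.
have [avb avE] : uniq [:: f x; v; head (f y) s] /\
    [set f x; v] \in E /\ [set v; head (f y) s] \in E.
  split; last by split; apply: sE; case: (s) => [|? ?]; rewrite /= !inE eqxx ?orbT.
  apply: subseq_uniq un; rewrite /= !eqxx.
  by case: (s) => [|? ?] /=; rewrite eqxx // sub0seq.
have [c1 [c1E le1]] := suppress_coloring hC avb avE.1 avE.2 cE.
have lt : #|linkage_interior (fun x' y' => [seq u <- p x' y' | u != v])| < n.
  apply: leq_trans len; apply: proper_card; apply/properP; split.
    apply/subsetP => u /linkage_interiorP[x' [y' [xy' hu]]].
    apply/linkage_interiorP; exists x', y'; split=> //.
    by move: hu; rewrite mem_filter => /andP[].
  exists v; first by apply/linkage_interiorP; exists x, y; rewrite pxy inE eqxx.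
  apply/negP => /linkage_interiorP[x' [y' [_]]].
  by rewrite mem_filter eqxx.
have [c2 [c2E le2]] := IH _ _ _ lt fp1 c1E.
by exists c2; split=> //; apply: leq_trans le1.
Qed.

(** * From partitions to colorings and back *)

Lemma vertex_brittleness_le (C : graph -> Prop) (G G' : graph) f p :
  ideal C -> @linkage G' G (edges G) f p ->
  enat_le (vertex_brittleness C G') (vertex_brittleness C G).
Proof.
move=> hC fp; apply: minimum_le => k [P [partP CP kE]].
have /and3P[/eqP covP trP _] := partP.
(* The color of an edge is the index of its part. *)
pose c e : nat := enum_rank (pblock P e).
have cE d e : d \in edges G -> (c d == c e) = (e \in pblock P d).
  move=> dE; rewrite /c (inj_eq val_inj) (inj_eq enum_rank_inj) eq_pblock //.
  by rewrite covP.
have cC : ideal_coloring C (edges G) c.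
  move=> e eE.
  have bP : pblock P e \in P by rewrite pblock_mem // covP.
  have bE : pblock P e \subset edges G.
    by rewrite -covP; apply: (bigcup_sup (pblock P e)).
  have -> : color_class (edges G) c (c e) = pblock P e.
    apply/setP => d; rewrite inE eq_sym cE // andb_idl //.
    exact: (subsetP bE).
  by apply/(edge_induced_span hC bE); apply: CP.
have [c' [c'E le]] := linkage_coloring hC fp cC.
(* The new parts are the nonempty fibers of [c']. *)
exists #|boundary (preim_partition c' (edges G'))|; last first.
  exists (preim_partition c' (edges G')); split=> //.
    exact: preim_partitionP.
  move=> F /imsetP[e eE ->].
  have sE : [set d in edges G' | c' e == c' d] \subset edges G'.
    by apply/subsetP => d; rewrite inE => /andP[].
  apply/(edge_induced_span hC sE).
  have := c'E e eE; congr (C (graph_of_subgraph (span _))).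
  by apply/setP => d; rewrite !inE eq_sym.
(* Two inclusions remain: the boundary of the new partition lies in the color boundary of [c'], and
   the color boundary of [c] lies in [boundary P]. *)
rewrite -kE; apply: leq_trans (leq_trans le _); apply/subset_leq_card/subsetP => u.
  rewrite inE => /exists_inP[A /imsetP[d0 d0E ->] /exists_inP[B /imsetP[e0 e0E ->]]].
  move=> /and3P[ne /bigcupP[d + ud] /bigcupP[e + ue]].
  rewrite inE => /andP[dE /eqP cd]; rewrite inE => /andP[eE /eqP ce].
  apply/color_boundaryP; exists d, e; split=> //.
  by apply: contraNneq ne; rewrite -cd -ce => ->.
move=> /color_boundaryP[d [e [dE eE ud ue ne]]].
have pb z : z \in edges G -> pblock P z \in P by move=> zE; rewrite pblock_mem ?covP.
have mb z : z \in edges G -> z \in pblock P z by move=> zE; rewrite mem_pblock covP.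
rewrite inE; apply/exists_inP; exists (pblock P d); first exact: pb.
apply/exists_inP; exists (pblock P e); first exact: pb.
apply/and3P; split.
- by apply: contraNneq ne; rewrite /c => ->.
- by apply/bigcupP; exists d => //; apply: mb.
- by apply/bigcupP; exists e => //; apply: mb.
Qed.

Theorem proposition1p8 (C : graph -> Prop) (hC : ideal C) (G G' : graph)
    (hG : topological_minor G' G) :
  enat_le (edit_distance C G') (edit_distance C G) /\
  enat_le (vertex_brittleness C G') (vertex_brittleness C G) /\
  enat_le (capacity C G') (capacity C G).
Proof.
have [f [p fp]] := topological_minor_linkage hG.
split; first exact: edit_distance_le fp.
by split; [exact: vertex_brittleness_le fp|exact: capacity_le fp].
Qed.
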